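(* Let $n\ge 1$ and $m\ge 0$ be integers, and let $\lambda\in\mathbb R^{n+m}$, $\bar\lambda\in\mathbb R^m$, $\nu\in\mathbb R^n$. Let $\nu'$ be a permutation of $\nu$ (i.e., $\nu'$ is obtained by permuting the entries of $\nu$). Then the polytopes $\mathcal{SC}(\lambda\setminus\bar\lambda,0^n,\nu)$ and $\mathcal{SC}(\lambda\setminus\bar\lambda,0^n,\nu')$ have the same $|V\setminus V_0|$-dimensional volume.
   Context: Trapezoidal arrays. For integers $n\ge 1$, $m\ge 0$ let $V=\{(i,j)\in\mathbb Z^2: 0\le i\le n,\ 0\le j\le i+m\}$. A trapezoidal array of size $(n,m)$ is a real array $X=(x_{ij})_{(i,j)\in V}\in\mathbb R^V$. Its row derivative is given by $\partial x_{ij}:=x_{ij}-x_{i,j-1}$ for $0\le i\le n$, $1\le j\le i+m$. The array $X$ is strip-concave if for all $i=1,\ldots,n$: $\partial x_{ij}\ge \partial x_{i-1,j}$ for $1\le j\le i-1+m$, and $\partial x_{i-1,j}\ge\partial x_{i,j+1}$ for $1\le j\le i+m-1$. $\mathcal{SC}_V$ denotes the set of strip-concave arrays $X\in\mathbb R^V$ with the normalization $x_{00}=0$. Boundary tuples of $X$: $\lambda^X_j:=\partial x_{nj}$ ($j=1,\ldots,n+m$), $\bar\lambda^X_j:=\partial x_{0j}$ ($j=1,\ldots,m$; empty if $m=0$), $\mu^X_i:=x_{i0}-x_{i-1,0}$ and $\nu^X_i:=x_{i,i+m}-x_{i-1,i-1+m}$ ($i=1,\ldots,n$). $\mathcal{SC}(\lambda\setminus\bar\lambda,0^n,\nu):=\{X\in\mathcal{SC}_V:(\lambda^X,\bar\lambda^X,\mu^X,\nu^X)=(\lambda,\bar\lambda,0^n,\nu)\}$,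 where $0^n$ is the zero $n$-tuple. $V_0$ denotes the set of boundary index pairs in $V$: those $(i,j)\in V$ with $i=0$, or $i=n$, or $j=0$, or $j=i+m$. All arrays in $\mathcal{SC}(\lambda\setminus\bar\lambda,0^n,\nu)$ have the same entries on $V_0$, so this polytope lies in a translate of the coordinate subspace $\mathbb R^{V\setminus V_0}$ of $\mathbb R^V$; its $|V\setminus V_0|$-dimensional volume is the Lebesgue measure in that translate (equivalently, of its coordinate projection to $\mathbb R^{V\setminus V_0}$). *)

(* Defs.v *)
From HB Require Import structures.
From mathcomp Require Import all_boot all_order all_algebra.
From mathcomp Require Import all_classical all_reals all_analysis.

Set Implicit Arguments.
Unset Strict Implicit.
Unset Printing Implicit Defensive.

Import Order.TTheory GRing.Theory Num.Theory.
Import numFieldNormedType.Exports.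

Local Open Scope classical_set_scope.
Local Open Scope ring_scope.

Section LebesgueTuple.
Variable R : realType.
Local Notation mR := (measurableTypeR R).

Definition tcons k (p : mR * k.-tuple mR) : k.+1.-tuple mR :=
  [tuple of p.1 :: p.2].

(* R^0 is a point of volume 1, and R^k.+1 = R * R^k carries the product
   measure. *)
Fixpoint lebesgue_tuple (k : nat) : set (k.-tuple mR) -> \bar R :=
  match k with
  | 0 => \d_([tuple] : 0.-tuple mR)
  | k'.+1 =>
      pushforward (@lebesgue_measure R \x @lebesgue_tuple k')%E (@tcons k')
  end.
Arguments lebesgue_tuple k A : clear implicits.

Lemma measurable_tcons k : measurable_fun setT (@tcons k).
Proof. by apply: measurable_cons; [exact: measurable_fst|exact: measurable_snd]. Qed.

Definition box k (A : 'I_k -> set mR) : set (k.-tuple mR) :=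
  [set t | forall i, A i (tnth t i)].

Lemma tcons_box k (A : 'I_k.+1 -> set mR) :
  @tcons k @^-1` box A = A ord0 `*` box (fun i => A (lift ord0 i)).
Proof.
apply/seteqP; split=> -[x t] /=.
  move=> h; split=> /=; first by have := h ord0; rewrite tnth0.
  by move=> i; have := h (lift ord0 i); rewrite tnthS.
by move=> [/= h0 h] i; case: (unliftP ord0 i) => [j ->|->]; rewrite ?tnthS ?tnth0.
Qed.

Lemma measurable_box k (A : 'I_k -> set mR) :
  (forall i, measurable (A i)) -> measurable (box A).
Proof.
move=> mA.
rewrite (_ : box A = \bigcap_(i in [set: 'I_k]) ((@tnth _ mR)^~ i @^-1` A i)).
  apply: fin_bigcap_measurable => // i _; rewrite -[X in measurable X]setTI.
  exact: measurable_tnth.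
by apply/seteqP; split=> t /= h => [i _|i]; exact: h.
Qed.

Section TconsMeasure.
Variables (k : nat) (mu : {sigma_finite_measure set (k.-tuple mR) -> \bar R}).

Definition tcons_measure : set (k.+1.-tuple mR) -> \bar R :=
  pushforward (@lebesgue_measure R \x mu)%E (@tcons k).

Let nuE A : tcons_measure A = (@lebesgue_measure R \x mu)%E (@tcons k @^-1` A).
Proof. by []. Qed.

Let nu0 : tcons_measure set0 = 0%E.
Proof. by rewrite nuE preimage_set0 measure0. Qed.

Let nu_ge0 A : (0 <= tcons_measure A)%E.
Proof. by rewrite nuE; exact: measure_ge0. Qed.

Let nu_sigma_additive : semi_sigma_additive tcons_measure.
Proof.
move=> F mF tF mUF; rewrite nuE preimage_bigcup.
apply: (@measure_semi_sigma_additive _ _ _ (lebesgue_measure \x mu)%E).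
- by move=> i; rewrite -[X in measurable X]setTI; exact: measurable_tcons.
- apply/trivIsetP => /= i j _ _ ij; rewrite -preimage_setI.
  by move/trivIsetP : tF => /(_ _ _ _ _ ij) ->//; rewrite preimage_set0.
- by rewrite -preimage_bigcup -[X in measurable X]setTI; exact: measurable_tcons.
Qed.

HB.instance Definition _ :=
  isMeasure.Build _ _ _ tcons_measure nu0 nu_ge0 nu_sigma_additive.

Let nu_sigma_finite : sigma_finite setT tcons_measure.
Proof.
have /sigma_finiteP[F [TF ndF Foo]] := sigma_finiteT (@lebesgue_measure R).
have /sigma_finiteP[G [TG ndG Goo]] := sigma_finiteT mu.
pose uncons (t : k.+1.-tuple mR) : mR * k.-tuple mR :=
  (thead t, [tuple of behead t]).
have tconsK : cancel (@tcons k) uncons.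
  by move=> [x t]; rewrite /uncons /= theadE; congr pair; exact: val_inj.
have munc : measurable_fun setT uncons.
  apply: measurable_fun_pair; last exact: measurable_behead.
  exact: measurable_tnth.
exists (fun i => uncons @^-1` (F i `*` G i)).
  apply/seteqP; split=> t // _.
  have [i _ Fi] : (\bigcup_i F i) (uncons t).1 by rewrite -TF.
  have [j _ Gj] : (\bigcup_i G i) (uncons t).2 by rewrite -TG.
  exists (maxn i j) => //; split.
    by move: Fi; exact/subsetPset/ndF/leq_maxl.
  by move: Gj; exact/subsetPset/ndG/leq_maxr.
move=> i; have [mF Fi] := Foo i; have [mG Gi] := Goo i; split.
  by rewrite -[X in measurable X]setTI; apply: munc => //; exact: measurableX.
rewrite nuE -comp_preimage (_ : uncons \o _ = id) ?preimage_id; last first.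
  by apply/funext => p; exact: tconsK.
by rewrite product_measure1E// lte_mul_pinfty// ge0_fin_numE.
Qed.

HB.instance Definition _ :=
  Measure_isSigmaFinite.Build _ _ _ tcons_measure nu_sigma_finite.

Lemma tcons_sigma_finite_measure :
  exists mu' : {sigma_finite_measure set (k.+1.-tuple mR) -> \bar R},
    pushforward (@lebesgue_measure R \x mu)%E (@tcons k) = mu'.
Proof. by exists tcons_measure. Qed.

End TconsMeasure.

Lemma lebesgue_tuple_sigma_finite_measure k :
  exists mu : {sigma_finite_measure set (k.-tuple mR) -> \bar R},
    lebesgue_tuple k = mu.
Proof.
elim: k => [|k [mu muE]]; first by exists \d_([tuple] : 0.-tuple mR).
by have [nu nuE] := tcons_sigma_finite_measure mu; exists nu; rewrite /= muE.
Qed.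

Let lebesgue_tuple0 k : lebesgue_tuple k set0 = 0%E.
Proof.
by have [mu ->] := lebesgue_tuple_sigma_finite_measure k; exact: measure0.
Qed.

Let lebesgue_tuple_ge0 k A : (0 <= lebesgue_tuple k A)%E.
Proof.
by have [mu ->] := lebesgue_tuple_sigma_finite_measure k; exact: measure_ge0.
Qed.

Let lebesgue_tuple_sigma_additive k : semi_sigma_additive (lebesgue_tuple k).
Proof.
have [mu ->] := lebesgue_tuple_sigma_finite_measure k.
exact: measure_semi_sigma_additive.
Qed.

HB.instance Definition _ k := isMeasure.Build _ _ _ (lebesgue_tuple k)
  (@lebesgue_tuple0 k) (@lebesgue_tuple_ge0 k) (@lebesgue_tuple_sigma_additive k).

Let lebesgue_tuple_sigma_finite k : sigma_finite setT (lebesgue_tuple k).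
Proof.
by have [mu ->] := lebesgue_tuple_sigma_finite_measure k; exact: sigma_finiteT.
Qed.

HB.instance Definition _ k := Measure_isSigmaFinite.Build _ _ _
  (lebesgue_tuple k) (@lebesgue_tuple_sigma_finite k).

Lemma lebesgue_tuple_box k (A : 'I_k -> set mR) :
  (forall i, measurable (A i)) ->
  lebesgue_tuple k (box A) = (\prod_(i < k) lebesgue_measure (A i))%E.
Proof.
elim: k A => [|k IH] A mA.
  rewrite big_ord0 /= diracE mem_set//= => -[]//.
rewrite big_ord_recl -IH//= /pushforward tcons_box.
by rewrite product_measure1E//; exact: measurable_box.
Qed.

End LebesgueTuple.
Arguments lebesgue_tuple R k A : clear implicits.

Section TrapezoidalArrays.
Variables (R : realType) (n m : nat).

(* Column indices are at most [i + m <= n + m]. *)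
Definition vertices : predArgType :=
  {v : 'I_n.+1 * 'I_(n + m).+1 | (v.2 <= v.1 + m)%N}.

Definition trap_array : Type := {ffun vertices -> R}.

Definition vertex00 : vertices := Sub (ord0, ord0) isT.

(* The vertex [(i, j)]; meaningful only for [i <= n] and [j <= i + m]. *)
Definition vertex (i j : nat) : vertices := insubd vertex00 (inord i, inord j).

Lemma vertexE (i j : nat) : (i <= n)%N -> (j <= i + m)%N ->
  ((val (vertex i j)).1 = i :> nat) * ((val (vertex i j)).2 = j :> nat).
Proof.
move=> lein leji.
have lejn : (j < (n + m).+1)%N by rewrite ltnS (leq_trans leji)// leq_add2r.
by rewrite val_insubd /= !inordK// leji /= !inordK.
Qed.

Implicit Types X : trap_array.

Definition entry X (i j : nat) : R := X (vertex i j).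

(* The row derivative, for [1 <= j]. *)
Definition rowd X (i j : nat) : R := entry X i j - entry X i j.-1.

Definition strip_concave X : Prop :=
  forall i : nat, (1 <= i <= n)%N ->
    (forall j : nat, (1 <= j <= i.-1 + m)%N -> rowd X i j >= rowd X i.-1 j) /\
    (forall j : nat, (1 <= j <= (i + m).-1)%N ->
       rowd X i.-1 j >= rowd X i j.+1).

Definition SC : set trap_array :=
  [set X | strip_concave X /\ entry X 0 0 = 0].

(* Tuples are indexed from 0: component [k] below is the one written with
   index [k + 1] in the usual convention. *)
Definition lambda_of X : (n + m).-tuple R := [tuple rowd X n k.+1 | k < n + m].
Definition lambdabar_of X : m.-tuple R := [tuple rowd X 0 k.+1 | k < m].
Definition mu_of X : n.-tuple R :=
  [tuple entry X k.+1 0 - entry X k 0 | k < n].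
Definition nu_of X : n.-tuple R :=
  [tuple entry X k.+1 (k.+1 + m) - entry X k (k + m) | k < n].

Definition SC_boundary (lam : (n + m).-tuple R) (lamb : m.-tuple R)
    (mu nu : n.-tuple R) : set trap_array :=
  [set X | SC X /\
    (lambda_of X, lambdabar_of X, mu_of X, nu_of X) = (lam, lamb, mu, nu)].

Definition V0 : {set vertices} :=
  [set v : vertices | let: (i, j) := val v in
    [|| i == 0 :> nat, i == n :> nat, j == 0 :> nat | j == i + m :> nat]%N].

Definition interior_proj X : #|~: V0|.-tuple (measurableTypeR R) :=
  [tuple X (enum_val k) | k < #|~: V0|].

(* The volume of a set of arrays sharing the same entries on [V0] is the
   Lebesgue measure of its projection to the coordinates outside [V0]. *)
Definition interior_volume (S : set trap_array) : \bar R :=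
  lebesgue_tuple R #|~: V0| (interior_proj @` S).

End TrapezoidalArrays.

(* Main.v *)
Require Import Defs.
From mathcomp Require Import all_boot all_order all_algebra.
From mathcomp Require Import all_classical all_reals all_analysis.
From mathcomp Require Import measurable_realfun zify ring lra.

(** The row derivatives of an array of [SC_boundary lam lamb 0 nu] form a skew
    Gelfand-Tsetlin pattern: consecutive rows interlace, the first and last
    rows are [lamb] and [lam], and [nu] is its weight, i.e. lists the
    differences of consecutive row sums, because column 0 vanishes and so the
    last entry of a row is the sum of its derivatives.
    Symmetry in the weight comes from the piecewise linear Bender-Knuth
    involutions.

    Fix the rows above and below row [p.+1].  Interlacing says exactly that
    each derivative of row [p.+1] lies in an interval [lower, upper] whose ends
    depend on these two rows only, and [toggle p] reflects every derivative of
    row [p.+1] in the midpoint of its interval.  This preserves strip-concavity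
    ([strip_concave_toggle]).  Each neighbouring derivative occurs among the
    ends exactly once, up to the pairing max + min = sum, so the ends add up to
    the sum of the two neighbouring rows ([sum_lower_upper]); hence the row sum
    s becomes s_above + s_below - s, which exchanges the weights of the two
    adjacent steps ([SC_boundary_toggle]).

    On the coordinates outside [V0], [toggle p] acts by t_k |-> c_k - t_k for
    the k in row [p.+1], where c_k depends on the other rows only, and fixes
    the rest.  Such a map is a composition of reflections in a single
    coordinate, each of which preserves Lebesgue measure by Fubini
    ([lebesgue_tuple_flip]).  So the volume for [nu] is at most the volume for
    [nu] with two adjacent entries exchanged ([le_interior_volume_swap]); the
    same argument gives the reverse inequality, and adjacent transpositions
    generate all permutations. *)

Set Implicit Arguments.
Unset Strict Implicit.
Unset Printing Implicit Defensive.

Import Order.TTheory GRing.Theory Num.Theory.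
Import numFieldNormedType.Exports.

(** * Permutations from adjacent transpositions *)

(** Bubble sort: the head of the first list is brought to the front of the
    second one.  The induction is on [F] applied behind an arbitrary prefix,
    since removing the common head must leave [F] unchanged. *)
Lemma eq_perm_of_adjacent_swap (T : eqType) (U : Type) (F : seq T -> U) :
  (forall s1 x y s2, F (s1 ++ x :: y :: s2) = F (s1 ++ y :: x :: s2)) ->
  forall s t, perm_eq s t -> F s = F t.
Proof.
move=> Fswap.
have Fmove p x t1 t2 : F (p ++ x :: t1 ++ t2) = F (p ++ t1 ++ x :: t2).
  elim: t1 p => //= y t1 IH p.
  by rewrite Fswap -cat_rcons IH cat_rcons.
suff Fcat s t p : perm_eq s t -> F (p ++ s) = F (p ++ t).
  by move=> s t; exact: (Fcat s t [::]).
elim: s t p => [|x s IH] t p.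
  by rewrite perm_sym => /perm_nilP ->.
move=> pst; have : x \in t by rewrite -(perm_mem pst) mem_head.
move=> /splitPr tE; case: tE pst => t1 t2.
rewrite perm_sym perm_catC /= perm_cons perm_catC perm_sym => pst.
by rewrite -Fmove -!cat_rcons; apply: IH.
Qed.

(** * Coordinate reflections and Lebesgue measure *)

Section Flip.
Local Open Scope classical_set_scope.
Local Open Scope ring_scope.
Variable R : realType.
Local Notation mR := (measurableTypeR R).

Lemma lebesgue_measure_reflection (c : R) (A : set R) :
  measurable A ->
  lebesgue_measure ((fun x : mR => c - x : mR) @^-1` A) =
  lebesgue_measure A :> \bar R.
Proof.
move=> mA.
have mc : @measurable_fun _ _ mR mR setT (fun x => c - x).
  exact: measurable_funB.
pose F : {mfun mR >-> mR} := @mfun_Sub _ _ mR mR _ (mem_set mc).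
apply/esym; rewrite -[RHS]/(pushforward lebesgue_measure F A).
apply: lebesgue_measure_unique => // _ [[a b]] _ <-.
rewrite /pushforward [X in _ = lebesgue_measure X]
  (_ : _ = `[c - b, c - a[%classic); last first.
  by apply/seteqP; split=> x /=; rewrite !in_itv /=; lra.
rewrite !lebesgue_measure_itv /= !lte_fin ltrD2l ltrN2.
by case: ifP => // _; congr EFin; ring.
Qed.

Definition flip k (s : seq 'I_k) (c : 'I_k -> k.-tuple mR -> mR)
    (t : k.-tuple mR) : k.-tuple mR :=
  [tuple if i \in s then c i t - tnth t i else tnth t i | i < k].

Lemma tnth_flip k (s : seq 'I_k) c t i :
  tnth (flip s c t) i = if i \in s then c i t - tnth t i else tnth t i.
Proof. exact: tnth_mktuple. Qed.

Lemma measurable_flip k (s : seq 'I_k) c :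
  (forall i, measurable_fun setT (c i)) -> measurable_fun setT (flip s c).
Proof.
move=> mc; apply/measurable_fun_tnthP => i.
apply: (eq_measurable_fun
  (fun t => if i \in s then c i t - tnth t i else tnth t i)) => [t _|].
  by rewrite /= tnth_flip.
have mi : measurable_fun [set: k.-tuple mR] (fun t => tnth t i).
  exact: measurable_tnth.
case: (i \in s); last exact: mi.
exact: (measurable_funB (mc i) mi).
Qed.

Definition independent_of k (c : k.-tuple mR -> mR) (s : seq 'I_k) :=
  forall t t' : k.-tuple mR,
    (forall i, i \notin s -> tnth t i = tnth t' i) -> c t = c t'.

(** By induction on the dimension: a reflection of a later coordinate acts on
    the sections at a fixed first coordinate, whereas a reflection of the first
    coordinate acts, after exchanging the order of integration, on lines by
    [x |-> c0 - x] with [c0] constant on each line. *)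
Lemma lebesgue_tuple_flip1 k (j : 'I_k) c (A : set (k.-tuple mR)) :
  measurable_fun setT c -> independent_of c [:: j] -> measurable A ->
  lebesgue_tuple R k (flip [:: j] (fun=> c) @^-1` A) = lebesgue_tuple R k A.
Proof.
elim: k => [|k IH] in j c A *; first by case: j.
move=> mc cj mA.
have mT (B : set (k.+1.-tuple mR)) : measurable B ->
    measurable (@tcons R k @^-1` B).
  by move=> mB; rewrite -[X in measurable X]setTI; exact: measurable_tcons.
have mF : measurable (flip [:: j] (fun=> c) @^-1` A).
  by rewrite -[X in measurable X]setTI; exact: measurable_flip.
case: (unliftP ord0 j) => [j'|] jE; rewrite /= /pushforward.
- apply: eq_integral => x _ /=.
  pose c' (t : k.-tuple mR) := c (tcons (x, t)).
  have key t : flip [:: j] (fun=> c) (tcons (x, t)) =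
      tcons (x, flip [:: j'] (fun=> c') t).
    apply: eq_from_tnth => i; rewrite tnth_flip jE inE.
    case: (unliftP ord0 i) => [i'|] ->; last by rewrite !tnth0.
    by rewrite (inj_eq lift_inj) !tnthS tnth_flip inE.
  rewrite -(IH j' c' (xsection (@tcons R k @^-1` A) x)).
  + congr (lebesgue_tuple _ _ _); apply/seteqP.
    by split=> t; rewrite /xsection /= !inE /= key.
  + apply: measurableT_comp => //.
    by apply: measurable_cons; [exact: measurable_cst|exact: measurable_id].
  + move=> t t' tt'; apply: cj => i; rewrite jE.
    case: (unliftP ord0 i) => [i'|] ->; last by rewrite !tnth0.
    by rewrite !inE (inj_eq lift_inj) !tnthS => /= ii'; apply: tt'; rewrite inE.
  + exact: measurable_xsection (mT _ mA).
- have E (B : set (k.+1.-tuple mR)) : measurable B ->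
     ((@lebesgue_measure R \x @lebesgue_tuple R k) (@tcons R k @^-1` B) =
     (@lebesgue_measure R \x^ @lebesgue_tuple R k) (@tcons R k @^-1` B))%E.
    move=> mB; apply: product_measure_unique; last exact: mT.
    exact: product_measure2E.
  rewrite !E //; apply: eq_integral => t _ /=.
  (* [c] ignores the first coordinate, so 0 can stand for any value of it. *)
  pose c0 := c (tcons (0, t)).
  have key x : flip [:: j] (fun=> c) (tcons (x, t)) = tcons (c0 - x : mR, t).
    apply: eq_from_tnth => i; rewrite tnth_flip jE inE.
    case: (unliftP ord0 i) => [i'|] ->; first by rewrite !tnthS.
    rewrite !tnth0; congr (_ - _); apply: cj => l; rewrite inE jE.
    by case: (unliftP ord0 l) => [l'|] -> //; rewrite !tnthS.
  have mAt := measurable_ysection t (mT _ mA).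
  rewrite -(lebesgue_measure_reflection c0 mAt).
  congr lebesgue_measure; apply/seteqP.
  by split=> x; rewrite /ysection /= !inE /= key.
Qed.

(** The coordinates in [s] can be reflected one after the other: the offsets
    [c i t] do not depend on any of them, so earlier reflections do not change
    them. *)
Lemma lebesgue_tuple_flip k (s : seq 'I_k) c (A : set (k.-tuple mR)) :
  uniq s -> (forall i, measurable_fun setT (c i)) ->
  (forall i, i \in s -> independent_of (c i) s) -> measurable A ->
  lebesgue_tuple R k (flip s c @^-1` A) = lebesgue_tuple R k A.
Proof.
elim: s A => [|j s IH] A /=.
  move=> *; congr lebesgue_tuple; apply/seteqP.
  have E t : flip [::] c t = t.
    by apply: eq_from_tnth => i; rewrite tnth_flip.
  by split=> t /=; rewrite E.
move=> /andP[js us] mc cs mA.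
have cindep i : i \in j :: s -> independent_of (c i) s.
  move=> ijs t t' tt'; apply: cs => // l; rewrite inE negb_or => /andP[_].
  exact: tt'.
have key t : flip (j :: s) c t = flip [:: j] c (flip s c t).
  apply: eq_from_tnth => i; rewrite !tnth_flip !inE.
  have [->|//] := eqVneq i j; rewrite (negbTE js) /=.
  congr (_ - _); apply: cindep; rewrite ?mem_head// => l ls.
  by rewrite tnth_flip (negbTE ls).
have E : flip (j :: s) c @^-1` A = flip s c @^-1` (flip [:: j] c @^-1` A).
  by apply/seteqP; split=> t /=; rewrite key.
rewrite E IH //; last 2 first.
- by move=> i si; apply: cindep; rewrite inE si orbT.
- by rewrite -[X in measurable X]setTI; exact: measurable_flip.
have -> : flip [:: j] c = flip [:: j] (fun=> c j).
  apply/funext => t; apply: eq_from_tnth => i; rewrite !tnth_flip inE.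
  by case: eqP => [->|].
rewrite lebesgue_tuple_flip1 // => t t' tt'; apply: cs; rewrite ?mem_head// => i.
by rewrite inE negb_or => /andP[ij _]; apply: tt'; rewrite inE.
Qed.

End Flip.

(** * Toggling a row *)

Section Toggle.
Local Open Scope classical_set_scope.
Local Open Scope ring_scope.
Variables (R : realType) (n m : nat).
Local Notation array := (trap_array R n m).
Local Notation vertices := (vertices n m).
Implicit Types (X Y : array) (p i j k : nat).

Definition vrow (v : vertices) : nat := (val v).1.
Definition vcol (v : vertices) : nat := (val v).2.

Lemma vertexK v : vertex n m (vrow v) (vcol v) = v.
Proof.
apply: val_inj; rewrite /vertex val_insubd /vrow /vcol !inord_val /=.
by case: v => -[a b] /= ->.
Qed.

Lemma sum_rowd X i k :
  \sum_(0 <= j < k) rowd X i j.+1 = entry X i k - entry X i 0.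
Proof. by rewrite /rowd /= telescope_sumr. Qed.

(** [lower X p j] and [upper X p j] are the bounds that interlacing with rows
    [p] and [p.+2] puts on derivative [j] of row [p.+1].  Row [p] has no
    derivative [p.+1 + m], so it gives no lower bound at the right end, and no
    derivative 0, so it gives no upper bound at the left end. *)
Definition lower X p j : R :=
  if (j <= p + m)%N then Num.max (rowd X p j) (rowd X p.+2 j.+1)
  else rowd X p.+2 j.+1.

Definition upper X p j : R :=
  if (1 < j)%N then Num.min (rowd X p.+2 j) (rowd X p j.-1)
  else rowd X p.+2 j.

(** Sends each derivative [a] of row [p.+1] to [lower + upper - a]; as an entry
    is the sum of the derivatives to its left when column 0 vanishes, the bounds
    are summed. *)
Definition toggle p X : array :=
  [ffun v => if vrow v == p.+1
             then \sum_(0 <= j < vcol v) (lower X p j.+1 + upper X p j.+1) - X v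
             else X v].

Lemma entry_toggle p X i j : (i <= n)%N -> (j <= i + m)%N ->
  entry (toggle p X) i j =
  if i == p.+1 then
    \sum_(0 <= k < j) (lower X p k.+1 + upper X p k.+1) - entry X i j
  else entry X i j.
Proof.
move=> iN jN; rewrite /entry ffunE /vrow /vcol.
by rewrite !(vertexE iN jN).
Qed.

Lemma rowd_toggle p X i j : (i <= n)%N -> (j < i + m)%N ->
  rowd (toggle p X) i j.+1 =
  if i == p.+1 then lower X p j.+1 + upper X p j.+1 - rowd X i j.+1
  else rowd X i j.+1.
Proof.
move=> iN jN; rewrite /rowd /= !entry_toggle //; last exact: ltnW.
by case: ifP => // _; rewrite big_nat_recr //=; ring.
Qed.

(** The lower bound at [j] and the upper bound at [j.+1] are the maximum and the
    minimum of the same two numbers, [rowd X p j] and [rowd X p.+2 j.+1], so they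
    add up to the sum of these; the two unpaired bounds are the first and the
    last derivative of row [p.+2]. *)
Lemma sum_lower_upper X p :
  \sum_(0 <= j < p.+1 + m) (lower X p j.+1 + upper X p j.+1) =
  (entry X p (p + m) - entry X p 0) +
  (entry X p.+2 (p.+2 + m) - entry X p.+2 0).
Proof.
rewrite -!sum_rowd big_split /= !addSn big_nat_recr //=.
rewrite [\sum_(0 <= i < (p + m).+1) upper _ _ _]big_nat_recl //=.
rewrite [X in _ = _ + X]big_nat_recr // big_nat_recl //=.
rewrite [lower X p (p + m).+1]/lower ltnn [upper X p 1]/upper /=.
pose mx j := Num.max (rowd X p j.+1) (rowd X p.+2 j.+2).
rewrite (eq_big_nat _ _ (F2 := mx)); last first.
  by move=> j /= jN; rewrite /lower jN.
rewrite (eq_big_nat _ _ (F1 := fun j => upper X p j.+2)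
  (F2 := fun j => rowd X p j.+1 + rowd X p.+2 j.+2 - mx j)); last first.
  move=> j _; rewrite /upper /mx /= -(addr_max_min (rowd X p j.+1)).
  by rewrite addrAC subrr add0r minC.
rewrite sumrB big_split /=; ring.
Qed.

Lemma lower_ge_above X p j : (j <= p + m)%N -> rowd X p j <= lower X p j.
Proof. by move=> jp; rewrite /lower jp le_max lexx. Qed.

Lemma lower_ge_below X p j : rowd X p.+2 j.+1 <= lower X p j.
Proof. by rewrite /lower; case: ifP => // _; rewrite le_max lexx orbT. Qed.

Lemma upper_le_below X p j : upper X p j <= rowd X p.+2 j.
Proof. by rewrite /upper; case: ifP => // _; rewrite ge_min lexx. Qed.

Lemma upper_le_above X p j : upper X p j.+2 <= rowd X p j.+1.
Proof. by rewrite /upper /= ge_min lexx orbT. Qed.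

Definition row_in_range p X := forall j, (j < p.+1 + m)%N ->
  lower X p j.+1 <= rowd X p.+1 j.+1 <= upper X p j.+1.

Lemma strip_concave_row_in_range p X :
  (p.+2 <= n)%N -> strip_concave X -> row_in_range p X.
Proof.
move=> pn scX j jp.
have [s1 s2] : _ /\ _ := scX p.+1 (ltnW pn).
have [s3 s4] : _ /\ _ := scX p.+2 pn.
rewrite /lower /upper; apply/andP; split.
- case: ifP => jm; rewrite ?ge_max; last by apply: s4; lia.
  by rewrite s1 ?s4 //=; lia.
- case: ifP => jm; rewrite ?le_min; last by apply: s3; lia.
  rewrite s3 /=; last lia.
  by case: j jp jm => // j jp jm; apply: s2; lia.
Qed.

(** Reflecting in the midpoint of [lower, upper] keeps a point inside, and the
    bounds are not moved because rows [p] and [p.+2] are not. *)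
Lemma strip_concave_toggle p X :
  (p.+2 <= n)%N -> strip_concave X -> strip_concave (toggle p X).
Proof.
move=> pn scX.
have r := strip_concave_row_in_range pn scX.
have r' j : (j < p.+1 + m)%N ->
  lower X p j.+1 <= rowd (toggle p X) p.+1 j.+1 <= upper X p j.+1.
  move=> jp; rewrite rowd_toggle ?eqxx//; last lia.
  by have := r j jp; lra.
have other i j : (i <= n)%N -> i != p.+1 -> (j < i + m)%N ->
    rowd (toggle p X) i j.+1 = rowd X i j.+1.
  by move=> iN ip jm; rewrite rowd_toggle// (negbTE ip).
move=> i /andP[]; case: i => // i _ iN; have [s1 s2] := scX i.+1 iN.
split=> -[//|j] jN; rewrite /= in jN *.
- have [ip|ip] := eqVneq i p; last have [ip'|ip'] := eqVneq i p.+1.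
  + rewrite ip in jN *; rewrite other//; [|lia..].
    have /andP[/(le_trans _) le _] := r' j (ltac:(lia)); apply: le.
    exact: lower_ge_above.
  + rewrite ip' in jN *; rewrite [leRHS]other//; [|lia..].
    have /andP[_ /le_trans] := r' j jN; apply; exact: upper_le_below.
  + by rewrite !other//; [exact: s1|lia..].
- have [ip|ip] := eqVneq i p; last have [ip'|ip'] := eqVneq i p.+1.
  + rewrite ip in jN *; rewrite [leRHS]other//; [|lia..].
    have /andP[_ /le_trans] := r' j.+1 (ltac:(lia)); apply.
    exact: upper_le_above.
  + rewrite ip' in jN *; rewrite other//; [|lia..].
    have /andP[/(le_trans _) le _] := r' j (ltac:(lia)); apply: le.
    exact: lower_ge_below.
  + by rewrite !other//; [exact: s2|lia..].
Qed.

End Toggle.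

(** * Effect on the boundary tuples *)

Section Boundary.
Local Open Scope classical_set_scope.
Local Open Scope ring_scope.
Variables (R : realType) (n m : nat).
Local Notation array := (trap_array R n m).
Implicit Types (X Y : array) (p i j k : nat).
Implicit Types (lam : (n + m).-tuple R) (lamb : m.-tuple R) (nu : n.-tuple R).

Lemma mktuple_nthP k (f : nat -> R) (t : k.-tuple R) :
  [tuple f i | i < k] = t <-> forall i, (i < k)%N -> f i = t`_i.
Proof.
split=> [<- i ik|ft].
  by rewrite -[i]/(nat_of_ord (Ordinal ik)) -tnth_nth tnth_mktuple.
by apply: eq_from_tnth => i; rewrite tnth_mktuple ft// (tnth_nth 0).
Qed.

Lemma SC_boundaryP lam lamb nu X :
  SC_boundary lam lamb [tuple 0 | _ < n] nu X <->
  [/\ strip_concave X,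
      forall i, (i <= n)%N -> entry X i 0 = 0,
      forall j, (j < n + m)%N -> rowd X n j.+1 = lam`_j,
      forall j, (j < m)%N -> rowd X 0 j.+1 = lamb`_j &
      forall i, (i < n)%N ->
        entry X i.+1 (i.+1 + m) - entry X i (i + m) = nu`_i].
Proof.
split.
- move=> [[scX X00] E]; split=> //.
  + elim=> // i IH iN; have /= Em := congr1 (fun q => q.1.2) E.
    have := congr1 (fun t => tnth t (Ordinal iN)) Em.
    by rewrite !tnth_mktuple /= IH ?(ltnW iN)// subr0.
  + exact/(mktuple_nthP (fun j => rowd X n j.+1))/(congr1 (fun q => q.1.1.1) E).
  + exact/(mktuple_nthP (fun j => rowd X 0 j.+1))/(congr1 (fun q => q.1.1.2) E).
  + exact/(mktuple_nthP
      (fun i => entry X i.+1 (i.+1 + m) - entry X i (i + m)))/(congr1 snd E).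
- move=> [scX X0 El Eb En]; split; first by split=> //; exact: X0.
  have -> : lambda_of X = lam by exact/(mktuple_nthP (fun j => rowd X n j.+1)).
  have -> : lambdabar_of X = lamb.
    exact/(mktuple_nthP (fun j => rowd X 0 j.+1)).
  have -> : nu_of X = nu.
    exact/(mktuple_nthP (fun i => entry X i.+1 (i.+1 + m) - entry X i (i + m))).
  have -> // : mu_of X = [tuple 0 | _ < n].
  by apply: eq_from_tnth => i; rewrite !tnth_mktuple !X0 ?subr0// ltnW.
Qed.

Lemma SC_boundary_eq_V0 lam lamb nu X Y v :
  SC_boundary lam lamb [tuple 0 | _ < n] nu X ->
  SC_boundary lam lamb [tuple 0 | _ < n] nu Y ->
  v \in V0 n m -> X v = Y v.
Proof.
move=> /SC_boundaryP[_ X0 Xl Xb Xn] /SC_boundaryP[_ Y0 Yl Yb Yn].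
have row0 j : (j <= m)%N -> entry X 0 j = entry Y 0 j.
  move=> jm; apply: (addIr (- 0)); rewrite -{1}(X0 0%N)// -(Y0 0%N)// -!sum_rowd.
  by apply: eq_big_nat => l lj; rewrite Xb ?Yb//; lia.
have rown j : (j <= n + m)%N -> entry X n j = entry Y n j.
  move=> jm; apply: (addIr (- 0)); rewrite -{1}(X0 n)// -(Y0 n)// -!sum_rowd.
  by apply: eq_big_nat => l lj; rewrite Xl ?Yl//; lia.
have last i : (i <= n)%N -> entry X i (i + m) = entry Y i (i + m).
  elim: i => [|i IH] iN; first exact: row0.
  by have := Xn i iN; rewrite -(Yn i iN) IH ?(ltnW iN)// => /addIr.
move=> vV; suff : entry X (vrow v) (vcol v) = entry Y (vrow v) (vcol v).
  by rewrite /entry vertexK.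
move: vV (valP v); rewrite inE /vrow /vcol.
case: (val v) => a b /= vV abm; have an : (a <= n)%N by rewrite -ltnS.
case/or4P : vV => /eqP E; rewrite E.
- by apply: row0; rewrite E in abm.
- by apply: rown; rewrite E in abm.
- by rewrite X0// Y0.
- exact: last.
Qed.

(** The sum of row [p.+1] changes from s to s_above + s_below - s, which turns
    the weights (s - s_above, s_below - s) of the two steps at this row into
    (s_below - s, s - s_above). *)
Lemma SC_boundary_toggle lam lamb nu nu' p X :
  (p.+2 <= n)%N -> nu`_p = nu'`_p.+1 -> nu`_p.+1 = nu'`_p ->
  (forall k, k != p -> k != p.+1 -> nu`_k = nu'`_k) ->
  SC_boundary lam lamb [tuple 0 | _ < n] nu X ->
  SC_boundary lam lamb [tuple 0 | _ < n] nu' (toggle p X).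
Proof.
move=> pn nup nup1 nuk /SC_boundaryP[scX X0 Xl Xb Xn]; apply/SC_boundaryP.
have Elast i : (i <= n)%N -> entry (toggle p X) i (i + m) =
    if i == p.+1 then entry X p (p + m) + entry X p.+2 (p.+2 + m) -
      entry X p.+1 (p.+1 + m)
    else entry X i (i + m).
  move=> iN; rewrite entry_toggle//; case: eqP => [ip|//].
  by rewrite ip sum_lower_upper !X0 ?subr0//; lia.
split.
- exact: strip_concave_toggle.
- move=> i iN; rewrite entry_toggle// big_geq// X0// subr0.
  by case: ifP.
- by move=> j jN; rewrite rowd_toggle// ifN ?Xl//; lia.
- by move=> j jN; rewrite rowd_toggle// Xb.
- move=> i iN; rewrite !Elast//; last exact: ltnW.
  rewrite eqSS; have [->|ip] := eqVneq i p.
    rewrite ifN -?nup1 -?Xn//; last by lia.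
    by ring.
  have [->|ip1] := eqVneq i p.+1; last by rewrite Xn ?nuk.
  by rewrite -nup -Xn; [ring|lia].
Qed.

End Boundary.

(** * Volume of the polytope *)

Section Volume.
Local Open Scope classical_set_scope.
Local Open Scope ring_scope.
Variables (R : realType) (n m : nat).
Local Notation mR := (measurableTypeR R).
Local Notation array := (trap_array R n m).
Local Notation N := #|~: V0 n m|.
Implicit Types (B X : array) (p i j k : nat) (t : N.-tuple mR).
Implicit Types (lam : (n + m).-tuple R) (lamb : m.-tuple R) (nu : n.-tuple R).

(** The array with interior coordinates [t] and the entries of [B] on [V0]: for
    [v] in [V0] the index is out of range and [nth] returns its default. *)
Definition fill B t : array :=
  [ffun v => nth (B v) t (index v (enum (~: V0 n m)))].

Lemma fill_V0 B t v : v \in V0 n m -> fill B t v = B v.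
Proof.
move=> vV; rewrite ffunE nth_default// size_tuple cardE leqNgt index_mem.
by rewrite mem_enum inE vV.
Qed.

Lemma fill_enum_val B t (k : 'I_N) : fill B t (enum_val k) = tnth t k.
Proof.
rewrite ffunE (tnth_nth (B (enum_val k))) index_uniq// ?enum_uniq// -cardE.
exact: ltn_ord.
Qed.

Lemma fill_interior_proj B X :
  (forall v, v \in V0 n m -> X v = B v) -> fill B (interior_proj X) = X.
Proof.
move=> XB; apply/ffunP => v; have [vV|vV] := boolP (v \in V0 n m).
  by rewrite fill_V0// XB.
have vC : v \in ~: V0 n m by rewrite inE.
by rewrite -(enum_rankK_in vC vC) fill_enum_val tnth_mktuple.
Qed.

Lemma interior_proj_fill B t : interior_proj (fill B t) = t.
Proof.
by apply: eq_from_tnth => k; rewrite tnth_mktuple fill_enum_val.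
Qed.

Lemma interior_proj_SC_boundary lam lamb nu B :
  SC_boundary lam lamb [tuple 0 | _ < n] nu B ->
  @interior_proj R n m @` SC_boundary lam lamb [tuple 0 | _ < n] nu =
  [set t | SC_boundary lam lamb [tuple 0 | _ < n] nu (fill B t)].
Proof.
move=> SB; apply/seteqP; split=> [_ [X SX <-]|t St] /=.
  by rewrite fill_interior_proj// => v; exact: SC_boundary_eq_V0 SX SB.
by exists (fill B t) => //; exact: interior_proj_fill.
Qed.

Lemma measurable_entry_fill B i j :
  measurable_fun setT (fun t => entry (fill B t) i j : mR).
Proof.
rewrite /entry; set v := vertex n m i j.
have [vV|vV] := boolP (v \in V0 n m).
  apply: (eq_measurable_fun (cst (B v : mR))); last exact: measurable_cst.
  by move=> t _; rewrite fill_V0.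
have vC : v \in ~: V0 n m by rewrite inE.
rewrite -(enum_rankK_in vC vC).
apply: (eq_measurable_fun (fun t => tnth t (enum_rank_in vC v))).
  by move=> t _; rewrite fill_enum_val.
exact: measurable_tnth.
Qed.

Lemma measurable_rowd_fill B i j :
  measurable_fun setT (fun t => rowd (fill B t) i j : mR).
Proof.
exact: (measurable_funB (measurable_entry_fill B i j)
                        (measurable_entry_fill B i j.-1)).
Qed.

Lemma measurable_sum_lower_upper B p k :
  measurable_fun setT (fun t => \sum_(0 <= j < k)
    (lower (fill B t) p j.+1 + upper (fill B t) p j.+1) : mR).
Proof.
apply: measurable_sum => j; apply: measurable_funD; rewrite /lower /upper.
- case: (_ <= _)%N; last exact: measurable_rowd_fill.
  exact: (measurable_maxr (measurable_rowd_fill _ _ _)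
                          (measurable_rowd_fill _ _ _)).
- case: (_ < _)%N; last exact: measurable_rowd_fill.
  exact: (measurable_minr (measurable_rowd_fill _ _ _)
                          (measurable_rowd_fill _ _ _)).
Qed.

Lemma measurable_forall d (T : measurableType d) (Q : set nat)
    (A : nat -> set T) :
  (forall k, Q k -> measurable (A k)) ->
  measurable [set x | forall k, Q k -> A k x].
Proof. by move=> mA; exact: bigcap_measurableType. Qed.

Lemma measurable_ler_set d (T : measurableType d) (f g : T -> mR) :
  measurable_fun setT f -> measurable_fun setT g ->
  measurable [set x | f x <= g x].
Proof.
move=> mf mg; rewrite -[X in measurable X]setTI.
have mle : measurable_fun setT (fun x => f x <= g x).
  exact: measurable_fun_ler.
exact: (mle measurableT [set true]).
Qed.

Lemma measurable_eqr_set d (T : measurableType d) (f g : T -> mR) :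
  measurable_fun setT f -> measurable_fun setT g ->
  measurable [set x | f x = g x].
Proof.
move=> mf mg.
rewrite (_ : [set x | _] = [set x | f x <= g x] `&` [set x | g x <= f x]).
  by apply: measurableI; exact: measurable_ler_set.
apply/seteqP; split=> x /=; first by move=> ->.
by move=> [fg gf]; apply/eqP; rewrite eq_le fg.
Qed.

Lemma measurable_SC_boundary_fill lam lamb nu B :
  measurable [set t | SC_boundary lam lamb [tuple 0 | _ < n] nu (fill B t)].
Proof.
rewrite (_ : [set t | _] =
  [set t | forall i, (1 <= i <= n)%N ->
    [set t | forall j, (1 <= j <= i.-1 + m)%N ->
       [set t | rowd (fill B t) i.-1 j <= rowd (fill B t) i j] t] t] `&`
  [set t | forall i, (1 <= i <= n)%N ->
    [set t | forall j, (1 <= j <= (i + m).-1)%N ->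
       [set t | rowd (fill B t) i j.+1 <= rowd (fill B t) i.-1 j] t] t] `&`
  [set t | forall i, (i <= n)%N -> [set t | entry (fill B t) i 0 = 0] t] `&`
  [set t | forall j, (j < n + m)%N ->
     [set t | rowd (fill B t) n j.+1 = lam`_j] t] `&`
  [set t | forall j, (j < m)%N ->
     [set t | rowd (fill B t) 0 j.+1 = lamb`_j] t] `&`
  [set t | forall i, (i < n)%N ->
     [set t | entry (fill B t) i.+1 (i.+1 + m) - entry (fill B t) i (i + m)
              = nu`_i] t]).
  have mr i j := measurable_rowd_fill B i j.
  have me i j := measurable_entry_fill B i j.
  repeat apply: measurableI.
  - apply: (measurable_forall (Q := fun i => (1 <= i <= n)%N)) => i _.
    apply: (measurable_forall (Q := fun j => (1 <= j <= i.-1 + m)%N)) => j _.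
    exact: measurable_ler_set (mr _ _) (mr _ _).
  - apply: (measurable_forall (Q := fun i => (1 <= i <= n)%N)) => i _.
    apply: (measurable_forall (Q := fun j => (1 <= j <= (i + m).-1)%N)) => j _.
    exact: measurable_ler_set (mr _ _) (mr _ _).
  - apply: (measurable_forall (Q := fun i => (i <= n)%N)) => i _.
    exact: measurable_eqr_set (me _ _) (measurable_cst _).
  - apply: (measurable_forall (Q := fun j => (j < n + m)%N)) => j _.
    exact: measurable_eqr_set (mr _ _) (measurable_cst _).
  - apply: (measurable_forall (Q := fun j => (j < m)%N)) => j _.
    exact: measurable_eqr_set (mr _ _) (measurable_cst _).
  - apply: (measurable_forall (Q := fun i => (i < n)%N)) => i _.
    exact: measurable_eqr_set (measurable_funB (me _ _) (me _ _))
                              (measurable_cst _).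
apply/seteqP; split=> t /=.
  by move=> /SC_boundaryP[sc *]; do 5?split=> //; move=> i iN; case: (sc i iN).
move=> [[[[[sc1 sc2] ?] ?] ?] ?]; apply/SC_boundaryP; split=> // i iN.
by split=> j jN; [exact: sc1|exact: sc2].
Qed.

Lemma measurable_interior_proj_SC_boundary lam lamb nu :
  measurable (@interior_proj R n m @`
    SC_boundary lam lamb [tuple 0 | _ < n] nu).
Proof.
have [[B SB]|SC0] := pselect (SC_boundary lam lamb [tuple 0 | _ < n] nu !=set0).
  by rewrite (interior_proj_SC_boundary SB); exact: measurable_SC_boundary_fill.
by move/set0P/negP/negPn/eqP : SC0 => ->; rewrite image_set0.
Qed.

Definition row_coords p : seq 'I_N :=
  enum [pred k : 'I_N | vrow (enum_val k) == p.+1].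

Definition toggle_offset B p (k : 'I_N) t : mR :=
  \sum_(0 <= j < vcol (enum_val k))
    (lower (fill B t) p j.+1 + upper (fill B t) p j.+1).

Lemma interior_proj_toggle B p t :
  interior_proj (toggle p (fill B t)) =
  flip (row_coords p) (toggle_offset B p) t.
Proof.
apply: eq_from_tnth => k; rewrite tnth_mktuple tnth_flip mem_enum inE ffunE.
by rewrite fill_enum_val.
Qed.

(** No bounds on [i] and [j] are needed: out of range, [vertex] either keeps row
    [i] or falls back to row 0, which is not [p.+1]. *)
Lemma vrow_vertex i j p : i != p.+1 -> vrow (vertex n m i j) != p.+1.
Proof.
move=> ip; rewrite /vrow /vertex val_insubd; case: ifP => //= _.
by rewrite /inord val_insubd; case: ifP.
Qed.

Lemma entry_fill_eq B p t t' i j :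
  (forall k : 'I_N, vrow (enum_val k) != p.+1 -> tnth t k = tnth t' k) ->
  i != p.+1 -> entry (fill B t) i j = entry (fill B t') i j.
Proof.
move=> tt' ip; rewrite /entry; have := vrow_vertex j ip.
set v := vertex n m i j => vp.
have [vV|vV] := boolP (v \in V0 n m); first by rewrite !fill_V0.
have vC : v \in ~: V0 n m by rewrite inE.
rewrite -(enum_rankK_in vC vC) !fill_enum_val; apply: tt'.
by rewrite enum_rankK_in.
Qed.

Lemma toggle_offset_independent B p (k : 'I_N) :
  independent_of (toggle_offset B p k) (row_coords p).
Proof.
move=> t t' tt'.
have E i j : i != p.+1 -> rowd (fill B t) i j = rowd (fill B t') i j.
  move=> ip; rewrite /rowd; congr (_ - _); apply: (@entry_fill_eq _ p) => // l lp;
  by apply: tt'; rewrite mem_enum.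
by apply: eq_bigr => j _; rewrite /lower /upper !E//; lia.
Qed.

(** In interior coordinates, toggling maps the polytope of [nu] into that of
    [nu'], and it preserves volume.  An inequality is enough, as the roles of
    [nu] and [nu'] can be exchanged; this avoids checking that [toggle] is an
    involution. *)
Lemma le_interior_volume_swap lam lamb nu nu' p :
  (p.+2 <= n)%N -> nu`_p = nu'`_p.+1 -> nu`_p.+1 = nu'`_p ->
  (forall k, k != p -> k != p.+1 -> nu`_k = nu'`_k) ->
  (interior_volume (SC_boundary lam lamb [tuple 0%R | _ < n] nu) <=
   interior_volume (SC_boundary lam lamb [tuple 0%R | _ < n] nu'))%E.
Proof.
move=> pn nup nup1 nuk; rewrite /interior_volume.
have [[B SB]|SC0] :=
  pselect (SC_boundary lam lamb [tuple 0 | _ < n] nu !=set0); last first.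
  move/set0P/negP/negPn/eqP : SC0 => ->; rewrite image_set0 measure0.
  exact: measure_ge0.
have mP := measurable_interior_proj_SC_boundary lam lamb nu'.
have mc (k : 'I_N) : measurable_fun setT (toggle_offset B p k).
  exact: measurable_sum_lower_upper.
have cindep (k : 'I_N) : k \in row_coords p ->
    independent_of (toggle_offset B p k) (row_coords p).
  by move=> _; exact: toggle_offset_independent.
rewrite -(lebesgue_tuple_flip (enum_uniq _) mc cindep mP).
apply: le_measure; rewrite ?inE.
- exact: measurable_interior_proj_SC_boundary.
- by rewrite -[X in measurable X]setTI; exact: measurable_flip.
rewrite (interior_proj_SC_boundary SB) => t /= St.
rewrite -interior_proj_toggle; exists (toggle p (fill B t)) => //.
exact: SC_boundary_toggle St.
Qed.

Lemma interior_volume_swap lam lamb nu nu' s1 x y s2 :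
  nu = s1 ++ x :: y :: s2 :> seq R -> nu' = s1 ++ y :: x :: s2 :> seq R ->
  interior_volume (SC_boundary lam lamb [tuple 0 | _ < n] nu) =
  interior_volume (SC_boundary lam lamb [tuple 0 | _ < n] nu').
Proof.
move=> nuE nuE'.
have pn : ((size s1).+2 <= n)%N by rewrite -(size_tuple nu) nuE size_cat /=; lia.
have [e1 e2 e3] : [/\ nu`_(size s1) = nu'`_(size s1).+1,
    nu`_(size s1).+1 = nu'`_(size s1)
  & forall k, k != size s1 -> k != (size s1).+1 -> nu`_k = nu'`_k].
  rewrite nuE nuE' !nth_cat !ltnn !subnn !ltnNge !leqnSn /= !subSnn.
  split=> // k k1 k2; rewrite !nth_cat; case: ltnP => // ks.
  have [l ->//] : exists l, (k - size s1 = l.+2)%N.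
  by exists (k - size s1 - 2)%N; lia.
apply/eqP; rewrite eq_le; apply/andP; split.
  exact: le_interior_volume_swap pn e1 e2 e3.
by apply: le_interior_volume_swap pn _ _ _ => // k k1 k2; rewrite e3.
Qed.

End Volume.

Theorem proposition1 (R : realType) (n m : nat) (hn : (1 <= n)%N)
    (lam : (n + m).-tuple R) (lamb : m.-tuple R) (nu nu' : n.-tuple R)
    (hperm : perm_eq nu nu') :
  interior_volume (SC_boundary lam lamb [tuple 0%R | _ < n] nu) =
  interior_volume (SC_boundary lam lamb [tuple 0%R | _ < n] nu').
Proof.
pose vol (t : n.-tuple R) :=
  interior_volume (SC_boundary lam lamb [tuple 0%R | _ < n] t).
(* Lists of the wrong length get the dummy volume 0. *)
pose F (s : seq R) := oapp vol 0%E (insub s : option (n.-tuple R)).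
have FE t : F (val t) = vol t by rewrite /F valK.
rewrite -/(vol nu) -/(vol nu') -!FE; apply: eq_perm_of_adjacent_swap hperm.
move=> s1 x y s2; rewrite /F.
case: insubP => [t tn tE|]; last first.
  by move=> sN; rewrite insubN//; move: sN; rewrite !size_cat.
case: insubP => [t' _ tE'|]; last by move: tn; rewrite !size_cat /= => ->.
exact: interior_volume_swap tE tE'.
Qed.
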